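(* Let $H:\mathbb R^n\times\mathbb R^n\to\mathbb R$, $H=H(p,y)$, be such that: for each $y\in\mathbb R^n$, $p\mapsto H(p,y)$ is convex; $\lim_{|p|\to\infty}\inf_{y\in\mathbb R^n}H(p,y)=+\infty$; and, for each $R>0$, $H$ is uniformly continuous and bounded on $B_R\times\mathbb R^n$. Fix $p\in\mathbb R^n$, $\mu>\overline H(p)$ and a compact subset $D\subseteq\mathbb R^n$. Suppose that $u\in\mathrm{USC}(\overline{\mathbb R^n\setminus D})$ is a subsolution and $v\in\mathrm{LSC}(\overline{\mathbb R^n\setminus D})$ is a supersolution of $$H(p+Du,y)=\mu\quad\text{in }\mathbb R^n\setminus D,$$ and that $$\liminf_{|x|\to\infty}\frac{v(x)}{|x|}>0\quad\text{and}\quad\limsup_{|x|\to\infty}\frac{u(x)}{|x|}<\infty.$$ Then $$\sup_{\mathbb R^n\setminus D}(u-v)=\sup_{\partial D}(u-v).$$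
   Context: $B_R=\{x\in\mathbb R^n:|x|<R\}$. $\mathrm{USC}(E)$ and $\mathrm{LSC}(E)$ denote the upper and lower semicontinuous functions $E\to\mathbb R$. Subsolutions and supersolutions are understood in the viscosity sense. For $p\in\mathbb R^n$, $\overline H(p)$ is defined as the infimum of all $\mu\in\mathbb R$ for which there exists a Lipschitz function $w:\mathbb R^n\to\mathbb R$ with $\lim_{|y|\to\infty}|y|^{-1}w(y)=0$ satisfying $H(p+Dw,y)\le\mu$ in $\mathbb R^n$ in the viscosity sense (equivalently, by convexity, almost everywhere).
   Formalization: The printed equality fails for semicontinuous u, v whose values jump on ∂D. Proved instead: the supremum of u−v over the closure of ℝⁿ∖D equals that over ∂D; the printed equality over ℝⁿ∖D is proved when u and v are continuous on that closure. *)

(* Defs.v *)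
From HB Require Import structures.
From mathcomp Require Import all_boot all_order all_algebra.
From mathcomp Require Import all_classical all_reals all_analysis.

Set Implicit Arguments.
Unset Strict Implicit.
Unset Printing Implicit Defensive.

Import Order.TTheory GRing.Theory Num.Theory.
Import numFieldNormedType.Exports.

Local Open Scope classical_set_scope.
Local Open Scope ring_scope.

Section EuclideanSpace.
Context {R : realType} {n : nat}.
Implicit Types (x : 'rV[R]_n) (A U : set 'rV[R]_n) (f : 'rV[R]_n -> R).

(* The library norm on ['rV[R]_n] is the sup norm.  It gives the same topology,
   uniform structure and Lipschitz functions, so library notions are used for
   those; |x| itself is Euclidean. *)
Definition enorm x : R := Num.sqrt (\sum_i x ord0 i ^+ 2).

Definition eball (r : R) : set 'rV[R]_n := [set x | enorm x < r].

(* The filter |x| -> oo. *)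
Definition at_infty : set_system 'rV[R]_n :=
  [set A | exists M : R, forall x, M < enorm x -> A x].

Global Instance at_infty_filter : Filter at_infty.
Proof.
split=> [|P Q [M HM] [N HN]|P Q PQ [M HM]].
- by exists 0.
- exists (Num.max M N) => x; rewrite gt_max => /andP[Mx Nx].
  by split; [exact: HM | exact: HN].
- by exists M => x /HM; exact: PQ.
Qed.

Definition boundary A : set 'rV[R]_n := closure A `\` interior A.

(* A function E -> R is represented by a total function of which only the
   values on E matter: points outside E are isolated in [subspace E]. *)
Definition lsc_on A f :=
  lower_semicontinuous (fun x : subspace A => (f x)%:E).

Definition usc_on A f := lsc_on A (fun x => - f x).

Definition grad f x : 'rV[R]_n := \row_i 'D_(delta_mx ord0 i) f x.

Definition C1_on U f :=
  (forall x, U x -> differentiable f x) /\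
  (forall x, U x -> {for x, continuous (grad f)}).

(* Viscosity sub- and supersolutions of F(Du, y) = mu in the open set U;
   semicontinuity is required separately. *)
Definition visc_subsolution (F : 'rV[R]_n -> 'rV[R]_n -> R) (mu : R) U
    (u : 'rV[R]_n -> R) :=
  forall phi x, C1_on U phi -> U x ->
    (\forall y \near x, u y - phi y <= u x - phi x) ->
    F (grad phi x) x <= mu.

Definition visc_supersolution (F : 'rV[R]_n -> 'rV[R]_n -> R) (mu : R) U
    (v : 'rV[R]_n -> R) :=
  forall phi x, C1_on U phi -> U x ->
    (\forall y \near x, v x - phi x <= v y - phi y) ->
    mu <= F (grad phi x) x.

Definition shiftH (H : 'rV[R]_n -> 'rV[R]_n -> R) (p : 'rV[R]_n) :
  'rV[R]_n -> 'rV[R]_n -> R := fun q y => H (p + q) y.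

Definition strictly_sublinear (w : 'rV[R]_n -> R) :=
  (enorm y)^-1 * w y @[y --> at_infty] --> (0 : R).

(* Infimum in the extended reals, so that no junk value arises when the set of
   admissible mu is empty or unbounded below. *)
Definition Hbar (H : 'rV[R]_n -> 'rV[R]_n -> R) (p : 'rV[R]_n) : \bar R :=
  ereal_inf [set mu%:E | mu in [set mu : R |
    exists w : 'rV[R]_n -> R,
      [/\ lipschitz w, strictly_sublinear w &
          visc_subsolution (shiftH H p) mu setT w]]].

End EuclideanSpace.

(* Main.v *)
Require Import Defs.
From mathcomp Require Import all_boot all_order all_algebra.
From mathcomp Require Import all_classical all_reals all_analysis.
From mathcomp Require Import ring lra.
Import Order.TTheory GRing.Theory Num.Theory.
Import numFieldNormedType.Exports.
Local Open Scope classical_set_scope.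
Local Open Scope ring_scope.

(* Let w be a sublinear subsolution at a level mu' < mu.  For 0 < l < 1 and S
   smooth with small gradient, l u + (1 - l) (w + S) is by convexity a strict
   subsolution, so it satisfies the comparison principle with v as soon as
   l u + (1 - l) (w + S) - v tends to -oo; this is proved by tripling the
   variables.  For small l the growth assumptions ensure this decay.  If
   l u - v decays linearly at some rate, taking for S cones of a fixed slope d
   truncated at radius k shows that, whatever that rate was, l u - v decays at
   least like -(1 - l) d |x| / 4.  Since u grows at most linearly, l can then be
   increased by a fixed proportion of 1 - l while preserving linear decay.
   Iterating gives values of l arbitrarily close to 1; comparison with S = 0
   followed by l -> 1 concludes. *)

Set Implicit Arguments.
Unset Strict Implicit.

Section EuclideanNorm.
Context {R : realType} {n : nat}.
Implicit Types x y z : 'rV[R]_n.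

Definition normsq x : R := \sum_i x ord0 i ^+ 2.

Lemma normsq_ge0 x : 0 <= normsq x.
Proof. by apply: sumr_ge0 => i _; exact: sqr_ge0. Qed.

Lemma enorm_ge0 x : 0 <= enorm x.
Proof. exact: sqrtr_ge0. Qed.

Lemma enorm_sqr x : enorm x ^+ 2 = normsq x.
Proof. by rewrite sqr_sqrtr// normsq_ge0. Qed.

Lemma normsqN x : normsq (- x) = normsq x.
Proof. by apply: eq_bigr => i _; rewrite mxE sqrrN. Qed.

Lemma normsqD x y : normsq (x + y) <= 2 * normsq x + 2 * normsq y.
Proof.
rewrite !mulr_sumr -big_split; apply: ler_sum => i _ /=; rewrite mxE.
have := sqr_ge0 (x ord0 i - y ord0 i); nra.
Qed.

Lemma coord_sqr_le_normsq x i : x ord0 i ^+ 2 <= normsq x.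
Proof.
rewrite /normsq (bigD1 i)//= lerDl.
by apply: sumr_ge0 => j _; exact: sqr_ge0.
Qed.

Lemma coord_le_enorm x i : `|x ord0 i| <= enorm x.
Proof.
rewrite -(@ler_pXn2r _ 2)// ?nnegrE ?enorm_ge0//.
by rewrite enorm_sqr real_normK ?num_real// coord_sqr_le_normsq.
Qed.

Lemma norm_ltP x (e : R) : 0 < e -> (forall i, `|x ord0 i| < e) -> `|x| < e.
Proof.
move=> e0 xe; rewrite [ltLHS]/Num.Def.normr /= mx_normrE.
by apply/bigmax_ltP; split=> // -[i j] _ /=; rewrite ord1.
Qed.

Lemma norm_le_enorm x : `|x| <= enorm x.
Proof.
apply/ler_addgt0Pl => e e0; apply/ltW/norm_ltP => [|i].
  by rewrite ltr_pwDl// enorm_ge0.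
by rewrite (le_lt_trans (coord_le_enorm x i))// ltrDr.
Qed.

Lemma normsq_le x (d : R) : (forall i, `|x ord0 i| <= d) ->
  normsq x <= n%:R * d ^+ 2.
Proof.
move=> xd; rewrite /normsq (le_trans (y := \sum_(i < n) d ^+ 2))//.
  apply: ler_sum => i _; rewrite -real_normK ?num_real//.
  by rewrite lerXn2r ?nnegrE// (le_trans _ (xd i)).
by rewrite sumr_const card_ord mulr_natl.
Qed.

End EuclideanNorm.

Section TestFunctions.
Context {R : realType} {n : nat}.
Implicit Types (f : 'rV[R]_n -> R) (g : 'rV[R]_n -> 'rV[R]_n).

Definition C1_with_grad f g :=
  [/\ forall x, differentiable f x, forall x, grad f x = g x & continuous g].

Lemma C1_with_grad_on f g U : C1_with_grad f g -> C1_on U f.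
Proof.
move=> [df gf cg]; split=> x Ux; first exact: df.
by have -> : grad f = g; [exact/funext|exact: cg].
Qed.

Lemma C1_with_grad_cst (a : R) :
  C1_with_grad (fun=> a) (fun=> 0 : 'rV[R]_n).
Proof.
split=> [x|x|]; [by []| |exact: cst_continuous].
by apply/rowP => i; rewrite !mxE derive_cst.
Qed.

Lemma C1_with_gradD f1 f2 g1 g2 : C1_with_grad f1 g1 -> C1_with_grad f2 g2 ->
  C1_with_grad (fun x => f1 x + f2 x) (fun x => g1 x + g2 x).
Proof.
move=> [df1 e1 c1] [df2 e2 c2]; split=> [x|x|x].
- exact: differentiableD.
- apply/rowP => i; rewrite -e1 -e2 !mxE.
  by rewrite deriveD//; exact: diff_derivable.
- exact: cvgD (c1 x) (c2 x).
Qed.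

Lemma C1_with_gradZ (a : R) f g : C1_with_grad f g ->
  C1_with_grad (fun x => a * f x) (fun x => a *: g x).
Proof.
move=> [df e c]; split=> [x|x|x].
- exact: (@differentiableZ _ _ _ f).
- apply/rowP => i; rewrite -e !mxE.
  by rewrite (@deriveZ _ _ _ f)//; exact: diff_derivable.
- exact: (cvgZ (cvg_cst a) (c x)).
Qed.

Lemma C1_with_grad_normsqB z :
  C1_with_grad (fun x => normsq (x - z)) (fun x => 2 *: (x - z)).
Proof.
have dc (x : 'rV[R]_n) i : differentiable (fun x : 'rV[R]_n => x ord0 i - z ord0 i : R) x.
  apply: (@differentiableB _ _ _ _ (fun=> z ord0 i)) => //.
  exact: differentiable_coord.
have dcoord (x : 'rV[R]_n) i j :
    'D_(delta_mx ord0 j) (fun x : 'rV[R]_n => x ord0 i - z ord0 i) x =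
    (j == i)%:R :> R.
  rewrite (@deriveB _ _ _ (fun x : 'rV[R]_n => x ord0 i) (fun=> z ord0 i))//; last first.
    exact/diff_derivable/differentiable_coord.
  rewrite derive_cst subr0.
  have /derive_mx/matrixP/(_ ord0 i) :
    derivable (@id 'rV[R]_n) x (delta_mx ord0 j) by exact: derivable_id.
  rewrite derive_id.
  by rewrite !mxE eqxx/= eq_sym.
have -> : (fun x => normsq (x - z)) =
    \sum_(i < n) (fun x : 'rV[R]_n => x ord0 i - z ord0 i) ^+ 2.
  apply/funext => x; rewrite fct_sumE; apply: eq_bigr => i _.
  by rewrite !mxE expr2.
split=> [x|x|x].
- by apply: differentiable_sum => i; exact: differentiableX.
- apply/rowP => i; rewrite !mxE derive_sum; last first.
    by move=> j; apply/derivableX/diff_derivable.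
  rewrite (bigD1 i)//= big1 ?addr0 => [|j ji].
    rewrite deriveX; last exact: diff_derivable.
    by rewrite dcoord eqxx scaler1 expr1.
  rewrite deriveX; last exact: diff_derivable.
  by rewrite dcoord eq_sym (negbTE ji) scaler0.
- apply: (@cvgZ _ _ _ (nbhs x) _ (fun=> 2) (fun x => x - z)).
    exact: cvg_cst.
  by apply: cvgB; [exact: cvg_id|exact: cvg_cst].
Qed.

Lemma C1_with_gradV (c : R) f g : 0 < c -> (forall x, 0 <= f x) ->
  C1_with_grad f g ->
  C1_with_grad (fun x => (c + f x)^-1) (fun x => - (c + f x) ^- 2 *: g x).
Proof.
move=> c0 f0 [df e cg].
have cf0 x : c + f x != 0 by rewrite gt_eqF// ltr_wpDr.
have dcf x : differentiable (fun x => c + f x) x.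
  by apply: (@differentiableD _ _ _ (fun=> c)).
split=> [x|x|x].
- exact: (@differentiableV _ _ (fun x => c + f x)).
- apply/rowP => i; rewrite -e !mxE.
  rewrite (@deriveV _ _ (fun x => c + f x))//; last exact: diff_derivable.
  rewrite (@deriveD _ _ _ (fun=> c))//; last exact: diff_derivable.
  by rewrite derive_cst add0r.
- apply: cvgZ (cg x); apply: cvgN; apply: cvgV; first by rewrite expf_neq0.
  apply: (@continuous_cvg _ _ _ (nbhs x) _ (fun x => c + f x) (fun t => t ^+ 2)).
    exact: exprn_continuous.
  apply: cvgD; first exact: cvg_cst.
  exact: differentiable_continuous.
Qed.

End TestFunctions.

Section Saturation.
Context {R : realType} {n : nat}.
Variables d k : R.
Hypotheses (d0 : 0 <= d) (k0 : 0 < k).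

(* Grows like a cone of slope of order d up to |x| = k, then saturates. *)
Definition saturated_cone (x : 'rV[R]_n) : R :=
  d * k * (normsq x / (k ^+ 2 + normsq x)).

Lemma saturated_cone_den_gt0 (x : 'rV[R]_n) : 0 < k ^+ 2 + normsq x.
Proof. by rewrite ltr_wpDr ?normsq_ge0// exprn_gt0. Qed.

Lemma saturated_cone_le x : saturated_cone x <= d * k.
Proof.
have D0 := saturated_cone_den_gt0 x.
rewrite -[leRHS]mulr1 ler_wpM2l ?mulr_ge0// ?(ltW k0)//.
by rewrite ler_pdivrMr// mul1r lerDr sqr_ge0.
Qed.

Lemma saturated_cone_le_normsq x : 1 <= k -> saturated_cone x <= d * normsq x.
Proof.
move=> k1; have D0 := saturated_cone_den_gt0 x; have N0 := normsq_ge0 x.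
rewrite /saturated_cone -mulrA ler_wpM2l// mulrA ler_pdivrMr//.
by rewrite mulrC ler_wpM2l//; nra.
Qed.

Lemma saturated_cone_at x : enorm x = k -> saturated_cone x = d * k / 2.
Proof.
move=> xk; rewrite /saturated_cone -enorm_sqr xk.
by field; rewrite gt_eqF// addr_gt0// exprn_gt0.
Qed.

Lemma saturated_cone_C1 : exists2 g,
  C1_with_grad saturated_cone g & forall x i, `|g x ord0 i| <= d.
Proof.
have c20 : 0 < k ^+ 2 by rewrite exprn_gt0.
have := C1_with_grad_normsqB (0 : 'rV[R]_n).
have -> : (fun x : 'rV[R]_n => normsq (x - 0)) = normsq.
  by apply/funext => x; rewrite subr0.
move=> /(C1_with_gradV c20 normsq_ge0)/(C1_with_gradZ (- (d * k ^+ 3))).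
move=> /(C1_with_gradD (C1_with_grad_cst (d * k))).
set f := (fun x => d * k + _); have -> : f = saturated_cone.
  apply/funext => x; have D0 := saturated_cone_den_gt0 x.
  by rewrite /f /saturated_cone; field; rewrite gt_eqF.
move=> C; eexists; first exact: C.
move=> x i /=; rewrite !mxE add0r subr0.
have D0 := saturated_cone_den_gt0 x.
rewrite (_ : _ * _ =
  d * ((2 * k * x ord0 i) * k ^+ 2 / (k ^+ 2 + normsq x) ^+ 2)); last first.
  by field; rewrite gt_eqF.
rewrite normrM (ger0_norm d0) ler_piMr//.
rewrite normrM normfV [X in _ / X]ger0_norm ?sqr_ge0// ler_pdivrMr ?exprn_gt0//.
rewrite mul1r normrM [leRHS]expr2 ler_pM//; last first.
  by rewrite ger0_norm ?(ltW c20)// lerDl normsq_ge0.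
have := coord_sqr_le_normsq x i; rewrite ler_norml.
have := sqr_ge0 (k - x ord0 i); have := sqr_ge0 (k + x ord0 i).
by move=> h1 h2 h3; apply/andP; split; nra.
Qed.

End Saturation.

Section UpperSemicontinuous.
Context {R : realType}.

Definition usc_within {T : topologicalType} (A : set T) (f : T -> R) :=
  forall x, A x -> forall a, f x < a -> \forall y \near within A (nbhs x), f y < a.

Lemma usc_within_on {n : nat} (A : set 'rV[R]_n) f : usc_on A f -> usc_within A f.
Proof.
move=> uf x Ax a fxa; have /uf[V] : ((- a)%:E < (- f x)%:E)%E by rewrite lte_fin ltrN2.
rewrite /nbhs/= -nbhs_subspace_in// => xV Vf.
by apply: filterS xV => y /Vf; rewrite lte_fin ltrN2.
Qed.

Context {T : topologicalType}.
Implicit Types (A : set T) (f g : T -> R).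

Lemma usc_withinS A B f : A `<=` B -> usc_within B f -> usc_within A f.
Proof.
move=> AB uf x Ax a fxa; have := uf x (AB x Ax) a fxa.
exact: within_subset.
Qed.

Lemma usc_withinD A f g : usc_within A f -> usc_within A g ->
  usc_within A (fun x => f x + g x).
Proof.
move=> uf ug x Ax a fga; set e := (a - (f x + g x)) / 2.
have e0 : 0 < e by rewrite divr_gt0// subr_gt0.
have uf' := uf x Ax (f x + e); have ug' := ug x Ax (g x + e).
near=> y; rewrite (_ : a = (f x + e) + (g x + e)); last by rewrite /e; field.
by apply: ltrD; near: y; [apply: uf'|apply: ug']; rewrite ltrDl.
Unshelve. all: by end_near. Qed.

Lemma usc_withinZ A (c : R) f : 0 < c -> usc_within A f ->
  usc_within A (fun x => c * f x).
Proof.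
move=> c0 uf x Ax a fa; have := uf x Ax (a / c).
rewrite ltr_pdivlMr// mulrC => /(_ fa); apply: filterS => y.
by rewrite ltr_pdivlMr// mulrC.
Qed.

Lemma continuous_usc_within A f : continuous f -> usc_within A f.
Proof.
move=> cf x Ax a fa; apply: cvg_within; rewrite /nbhs/=.
by have := cf x _ (lt_nbhsl fa).
Qed.

Lemma usc_within_comp {S : topologicalType} (h : S -> T) A B f :
  continuous h -> (forall x, B x -> A (h x)) -> usc_within A f ->
  usc_within B (f \o h).
Proof.
move=> ch BA uf x Bx a fa.
have hA : \forall y \near x, A (h y) -> f (h y) < a.
  exact: (ch x _ (uf (h x) (BA x Bx) a fa)).
rewrite near_withinE.
by apply: filterS hA => y /= fhy By; apply: fhy; exact: BA.
Qed.

Lemma usc_within_max A f : compact A -> A !=set0 -> usc_within A f ->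
  exists2 x, A x & forall y, A y -> f y <= f x.
Proof.
move=> cA [a0 Aa0] uf.
pose F := filter_from A (fun y => [set x | A x /\ f y <= f x]).
have PF : ProperFilter F.
  apply: filter_from_proper; last by move=> y Ay; exists y.
  apply: filter_from_filter; first by exists a0.
  move=> y z Ay Az; have [yz|zy] := leP (f y) (f z).
    by exists z => // x [Ax zx]; split; split=> //; exact: le_trans zx.
  by exists y => // x [Ax zx]; split; split=> //; rewrite (le_trans (ltW zy)).
have [|x [Ax clx]] := cA F PF.
  by exists a0 => // x [].
exists x => // y Ay; rewrite leNgt; apply/negP => fxy.
have Fy : F [set x | A x /\ f y <= f x] by exists y.
have [z [[Az fyz] /= /(_ Az)]] := clx _ _ Fy (uf x Ax _ fxy).
by rewrite ltNge fyz.
Qed.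

Lemma usc_within_bounded A f : compact A -> usc_within A f ->
  exists M, forall y, A y -> f y <= M.
Proof.
move=> cA uf; have [->|/set0P A0] := eqVneq A set0; first by exists 0.
by have [x _ fx] := usc_within_max cA A0 uf; exists (f x).
Qed.

End UpperSemicontinuous.

Section Tripling.
Context {R : realType} {n : nat}.
Implicit Types (K : set 'rV[R]_n) (a b c : 'rV[R]_n -> R).

Lemma normsq_continuous : continuous (@normsq R n).
Proof.
move=> x; apply: differentiable_continuous.
have [+ _ _] := C1_with_grad_normsqB (0 : 'rV[R]_n).
have -> : (fun x : 'rV[R]_n => normsq (x - 0)) = normsq.
  by apply/funext => y; rewrite subr0.
exact.
Qed.

Lemma normsq_eq0 (x : 'rV[R]_n) : normsq x <= 0 -> x = 0.
Proof.
move=> x0; apply/rowP => i; rewrite mxE; apply/eqP.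
by rewrite -sqrf_eq0 eq_le sqr_ge0 (le_trans (coord_sqr_le_normsq x i)).
Qed.

Definition penalty (x y z : 'rV[R]_n) := normsq (x - z) + normsq (y - z).

Lemma penalized_maxima K a b c x0 : compact K -> K x0 ->
  usc_within K a -> usc_within K b -> usc_within K c ->
  exists xh, [/\ K xh, a x0 + b x0 + c x0 <= a xh + b xh + c xh &
   forall e, 0 < e -> exists (k : R) x y z,
     [/\ 0 < k, [/\ K x, K y & K z],
         [/\ ball xh e x, ball xh e y & ball xh e z] &
         forall x' y' z', K x' -> K y' -> K z' ->
           a x' + b y' + c z' - k * penalty x' y' z' <=
           a x + b y + c z - k * penalty x y z]].
Proof.
move=> cK Kx0 ua ub uc.
pose K3 := K `*` K `*` K.
have cK3 : compact K3 by apply: compact_setX => //; exact: compact_setX.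
pose F (X : 'rV[R]_n * 'rV[R]_n * 'rV[R]_n) : R := a X.1.1 + b X.1.2 + c X.2.
pose P (X : 'rV[R]_n * 'rV[R]_n * 'rV[R]_n) := penalty X.1.1 X.1.2 X.2.
have c11 : continuous (fun X : 'rV[R]_n * 'rV[R]_n * 'rV[R]_n => X.1.1).
  by move=> X; apply: continuous_comp; apply: cvg_fst.
have c12 : continuous (fun X : 'rV[R]_n * 'rV[R]_n * 'rV[R]_n => X.1.2).
  by move=> X; apply: continuous_comp; [apply: cvg_fst|apply: cvg_snd].
have c2 : continuous (fun X : 'rV[R]_n * 'rV[R]_n * 'rV[R]_n => X.2).
  by move=> X; apply: cvg_snd.
have uF : usc_within K3 F.
  apply: usc_withinD; first apply: usc_withinD.
  - by apply: (usc_within_comp c11 _ ua) => X [[]].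
  - by apply: (usc_within_comp c12 _ ub) => X [[]].
  - by apply: (usc_within_comp c2 _ uc) => X [[]].
have cP : continuous P.
  move=> X; apply: cvgD.
    apply: (@continuous_comp _ _ _
      (fun X : 'rV[R]_n * 'rV[R]_n * 'rV[R]_n => X.1.1 - X.2)).
      exact: cvgB (c11 X) (c2 X).
    exact: normsq_continuous.
  apply: (@continuous_comp _ _ _
    (fun X : 'rV[R]_n * 'rV[R]_n * 'rV[R]_n => X.1.2 - X.2)).
    exact: cvgB (c12 X) (c2 X).
  exact: normsq_continuous.
have K30 : K3 (x0, x0, x0) by [].
have maxk (m : nat) : exists X, K3 X /\
    forall Y, K3 Y -> F Y - m.+1%:R * P Y <= F X - m.+1%:R * P X.
  have [X KX mX] : exists2 X, K3 X &
    forall Y, K3 Y -> F Y + - (m.+1%:R * P Y) <= F X + - (m.+1%:R * P X).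
    apply: usc_within_max => //; first by exists (x0, x0, x0).
    apply: usc_withinD => //; apply: continuous_usc_within => X.
    by apply: cvgN; apply: cvgM; [exact: cvg_cst|exact: cP].
  by exists X.
have {maxk} [X /all_and2[KX mX]] := choice maxk.
have P0 : P (x0, x0, x0) = 0.
  rewrite /P /penalty/= subrr /normsq big1 ?addr0// => i _.
  by rewrite mxE expr0n.
have Pge0 Y : 0 <= P Y by rewrite addr_ge0 ?normsq_ge0.
have [A FA] := usc_within_bounded cK3 uF.
have FX m : F (x0, x0, x0) + m.+1%:R * P (X m) <= F (X m).
  by have := mX m _ K30; rewrite P0 mulr0 subr0 lerBrDr.
have [|Xh [KXh clX]] := cK3 (X @ \oo) _.
  by exists 0%N => // m _; exact: KX.
have FXh : F (x0, x0, x0) <= F Xh.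
  rewrite leNgt; apply/negP => /(uF _ KXh) nF.
  have [|Y [[m ->] /= /(_ (KX m))]] := clX [set Y | exists m, Y = X m] _ _ nF.
    by exists 0%N => // m _; exists m.
  rewrite ltNge (le_trans _ (FX m))// lerDl mulr_ge0//.
have PXh : P Xh <= 0.
  rewrite leNgt; apply/negP => PXh.
  have nP : \forall Y \near Xh, P Xh / 2 < P Y.
    have Pr : P Xh / 2 < P Xh by rewrite ltr_pdivrMr// ltr_pMr// ltr1n.
    exact: (cP Xh _ (lt_nbhsr Pr)).
  pose B := (A - F (x0, x0, x0)) / (P Xh / 2).
  have [|Y [[m Bm ->] /=]] := clX [set Y | exists2 m, B < m.+1%:R & Y = X m] _ _ nP.
    suff BN : \forall m \near \oo, B < m.+1%:R.
      by apply: (filterS _ (BN : nbhs \oo _)) => m Bm; exists m.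
    near=> m; rewrite (lt_trans (y := m%:R)) ?ltr_nat//.
    by near: m; exact: nbhs_infty_gtr.
  apply/negP; rewrite -leNgt.
  rewrite -(ler_pM2l (ltr0Sn _ m)).
  rewrite (le_trans (y := A - F (x0, x0, x0)))//.
    by rewrite lerBrDl (le_trans (FX m))// FA.
  by move: Bm; rewrite ltr_pdivrMr ?divr_gt0// => /ltW.
case: Xh KXh FXh PXh clX => [[x y] z] [[/= Kx Ky] Kz] FXh PXh clX.
have xz : x = z.
  apply/eqP; rewrite -subr_eq0; apply/eqP/normsq_eq0.
  by apply: le_trans PXh; rewrite lerDl normsq_ge0.
have yz : y = z.
  apply/eqP; rewrite -subr_eq0; apply/eqP/normsq_eq0.
  by apply: le_trans PXh; rewrite lerDr normsq_ge0.
subst x y; exists z; split => // e e0.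
have nB : nbhs (z, z, z) (ball z e `*` ball z e `*` ball z e).
  exists (ball z e `*` ball z e, ball z e) => //=; split; last exact: nbhsx_ballx.
  by exists (ball z e, ball z e) => //=; split; exact: nbhsx_ballx.
have [|Y [[m ->] [[/= Bx By] Bz]]] := clX [set Y | exists m, Y = X m] _ _ nB.
  by exists 0%N => // m _; exists m.
exists m.+1%:R, (X m).1.1, (X m).1.2, (X m).2; split => //.
  by have [[]] := KX m.
by move=> x' y' z' Kx' Ky' Kz'; have := mX m (x', y', z'); apply.
Unshelve. all: by end_near. Qed.
End Tripling.

Section Comparison.
Context {R : realType} {n : nat}.
Variables (F : 'rV[R]_n -> 'rV[R]_n -> R) (mu mu' : R) (Q U : set 'rV[R]_n).
Variables u v w : 'rV[R]_n -> R.
Hypothesis F_convex : forall (t : R) (a b y : 'rV[R]_n), 0 <= t <= 1 ->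
  F (t *: a + (1 - t) *: b) y <= t * F a y + (1 - t) * F b y.
Hypothesis F_coercive : forall m, exists r, forall q y, F q y <= m -> normsq q <= r.
Hypothesis F_unif : forall r e : R, 0 < e -> exists2 d : R, 0 < d &
  forall q1 q2 y1 y2 : 'rV[R]_n, normsq q1 < r -> normsq q2 < r ->
    `|q1 - q2| < d -> `|y1 - y2| < d -> `|F q1 y1 - F q2 y2| < e.
Hypothesis mu_lt : mu' < mu.
Hypotheses (Q_closed : closed Q) (U_open : open U) (UQ : U `<=` Q).
Hypotheses (u_usc : usc_within Q u) (v_lsc : usc_within Q (fun x => - v x)).
Hypothesis w_cont : continuous w.
Hypothesis u_sub : visc_subsolution F mu U u.
Hypothesis v_super : visc_supersolution F mu U v.
Hypothesis w_sub : visc_subsolution F mu' setT w.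

Lemma normsq_ball_compact (r : R) : compact (Q `&` [set x | normsq x <= r]).
Proof.
apply: bounded_closed_compact; last first.
  apply: closedI => //.
  by apply: (@closed_comp _ _ _ [set t : R | t <= r]) => [x _|];
    [exact: normsq_continuous|exact: closed_le].
exists (Num.max r 1); split; first exact: num_real.
move=> M; rewrite gt_max => /andP[rM M1] x [_ /= xr].
rewrite (le_trans (norm_le_enorm x))//.
rewrite -(@ler_pXn2r _ 2)// ?nnegrE ?enorm_ge0 ?(le_trans ler01 (ltW M1))//.
rewrite enorm_sqr (le_trans xr)// (le_trans (ltW rM))//.
by rewrite expr2 ler_peMr ?(le_trans ler01)// ltW.
Qed.

Lemma strict_comparison : exists2 d : R, 0 < d &
  forall (l b : R) (S : 'rV[R]_n -> R) (g : 'rV[R]_n -> 'rV[R]_n),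
  0 < l < 1 -> C1_with_grad S g -> (forall x i, `|g x ord0 i| <= d) ->
  (exists r, forall x, Q x -> r < normsq x ->
     l * u x + (1 - l) * (w x + S x) - v x <= b) ->
  (forall x, Q x -> ~ U x -> l * u x + (1 - l) * (w x + S x) - v x <= b) ->
  forall x, Q x -> l * u x + (1 - l) * (w x + S x) - v x <= b.
Proof.
have [r0 Fr0] := F_coercive mu.
have gap0 : 0 < mu - mu' by rewrite subr_gt0.
have [r [r_pos qr qgr]] : exists r, [/\ 0 < r,
    forall q y, F q y <= mu -> normsq q < r &
    forall q (g : 'rV[R]_n) y, F q y <= mu -> (forall i, `|g ord0 i| <= 1) ->
      normsq (q + g) < r].
  exists (2 * Num.max r0 0 + 2 * n%:R + 1); split.
  - by rewrite ltr_wpDl// addr_ge0// mulr_ge0// ?le_max ?lexx ?orbT.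
  - move=> q y /Fr0 qr0.
    have : normsq q <= Num.max r0 0 by rewrite le_max qr0.
    have := normsq_ge0 q; have := ler0n R n; lra.
  - move=> q g y /Fr0 qr0 /normsq_le; rewrite expr1n mulr1 => gn.
    have : normsq q <= Num.max r0 0 by rewrite le_max qr0.
    have := normsqD q g; lra.
have [d1 d10 Fd1] := F_unif r (divr_gt0 gap0 (ltr0Sn R 1)).
pose d := Num.min 1 (d1 / 2).
have d0 : 0 < d by rewrite lt_min ltr01 divr_gt0.
have [dle1 dd1] : d <= 1 /\ d < d1.
  split; first by rewrite ge_min lexx.
  by rewrite gt_min orbC ltr_pdivrMr// ltr_pMr// ltr1n.
exists d => // l b S g /andP[l0 l1] CS gd [rho far] bdry x0 Qx0.
rewrite leNgt; apply/negP => bx0.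
pose K := Q `&` [set x | normsq x <= rho + 1].
have cK : compact K := @normsq_ball_compact (rho + 1).
have Sc : continuous S by move=> x; apply: differentiable_continuous; case: CS.
have l'0 : 0 < 1 - l by rewrite subr_gt0.
have x0rho : normsq x0 <= rho.
  by rewrite leNgt; apply/negP => /(far _ Qx0); rewrite leNgt bx0.
have Kx0 : K x0 by split=> //=; rewrite (le_trans x0rho)// lerDl.
have KQ : K `<=` Q by move=> x [].
have [|||xh [Kxh x0xh maxh]] := @penalized_maxima R n K (fun x => l * u x)
  (fun x => (1 - l) * (w x + S x)) (fun x => - v x) x0 cK Kx0.
- exact/(usc_withinS KQ)/usc_withinZ.
- apply: usc_withinZ => //; apply: continuous_usc_within => x.
  by apply: continuousD; [exact: w_cont|exact: Sc].
- exact: usc_withinS KQ v_lsc.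
have {}x0xh := lt_le_trans bx0 x0xh.
have Uxh : U xh.
  apply: contrapT => nUxh; move: x0xh.
  by rewrite ltNge bdry//; exact: KQ.
have xhrho : normsq xh < rho + 1.
  rewrite (@le_lt_trans _ _ rho)// ?ltrDl// leNgt; apply/negP => /far.
  by move=> /(_ (KQ _ Kxh)); rewrite leNgt x0xh.
have [e1 /= e10 He1] : nbhs_ball xh (U `&` [set x | normsq x < rho + 1]).
  apply/nbhs_ballP; apply: filterI; first exact: open_nbhs_nbhs.
  exact: (normsq_continuous (lt_nbhsl xhrho)).
have [d2 d20 Fd2] := F_unif r (mulr_gt0 l'0 (divr_gt0 gap0 (ltr0Sn R 1))).
pose e := Num.min e1 (Num.min d1 d2 / 2).
have e0 : 0 < e by rewrite lt_min e10 divr_gt0// lt_min d10.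
have [k [x [y [z [k0 [Kx Ky Kz] [Bx By Bz] kmax]]]]] := maxh _ e0.
have BK : ball xh e `<=` U `&` K.
  have ee1 : e <= e1 by rewrite ge_min lexx.
  move=> t /(le_ball ee1)/He1[Ut /= tr]; split=> //; split; first exact: UQ.
  exact: ltW.
have dist t t' : ball xh e t -> ball xh e t' -> `|t - t'| < d1 /\ `|t - t'| < d2.
  rewrite -ball_normE /= => Bt Bt'.
  have : `|t - t'| < Num.min d1 d2.
    rewrite (splitr (Num.min d1 d2)).
    rewrite (_ : t - t' = (xh - t') - (xh - t)); last first.
      by rewrite opprB [RHS]addrC addrA subrK.
    rewrite (le_lt_trans (ler_normB _ _))// ltrD//.
      by rewrite (lt_le_trans Bt')// ge_min lexx orbT.
    by rewrite (lt_le_trans Bt)// ge_min lexx orbT.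
  by rewrite lt_min => /andP[].
have nearK t : ball xh e t -> \forall s \near t, K s.
  move=> Bt; have : nbhs t (ball xh e).
    by apply: open_nbhs_nbhs; split => //; exact: ball_open.
  by apply: filterS => s /BK[].
pose qu := (k / l) *: (2 *: (x - z)).
pose qw := (k / (1 - l)) *: (2 *: (y - z)) + (-1) *: g y.
pose qv := (- k) *: (2 *: (z - x)) + (- k) *: (2 *: (z - y)).
have Fu : F qu x <= mu.
  have C := C1_with_gradZ (k / l) (C1_with_grad_normsqB z).
  have [_ gC _] := C; rewrite /qu -gC.
  apply: u_sub; [exact: C1_with_grad_on C|by have [] := BK _ Bx|].
  apply: filterS (nearK _ Bx) => x' Kx'.
  have := kmax x' y z Kx' Ky Kz; rewrite /penalty => h; rewrite -(ler_pM2l l0) /=.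
  have E a b' : l * (a - k / l * b') = l * a - k * b' by field; rewrite gt_eqF.
  by rewrite !E; lra.
have Fw : F qw y <= mu'.
  have C := C1_with_gradD
    (C1_with_gradZ (k / (1 - l)) (C1_with_grad_normsqB z)) (C1_with_gradZ (-1) CS).
  have [_ gC _] := C; rewrite /qw -gC.
  apply: w_sub; [exact: C1_with_grad_on C|by []|].
  apply: filterS (nearK _ By) => y' Ky'.
  have := kmax x y' z Kx Ky' Kz; rewrite /penalty => h; rewrite -(ler_pM2l l'0) /=.
  have E a b' s : (1 - l) * (a - (k / (1 - l) * b' + -1 * s)) =
    (1 - l) * (a + s) - k * b' by field; rewrite gt_eqF.
  by rewrite !E; lra.
have Fv : mu <= F qv z.
  have C := C1_with_gradD
    (C1_with_gradZ (- k) (C1_with_grad_normsqB x))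
    (C1_with_gradZ (- k) (C1_with_grad_normsqB y)).
  have [_ gC _] := C; rewrite /qv -gC.
  apply: v_super; [exact: C1_with_grad_on C|by have [] := BK _ Bz|].
  apply: filterS (nearK _ Bz) => z' Kz'.
  have := kmax x y z' Kx Ky Kz'; rewrite /penalty.
  rewrite -(normsqN (x - z')) -(normsqN (y - z')) -(normsqN (x - z)) -(normsqN (y - z)).
  by rewrite !opprB; lra.
have qvE : qv = l *: qu + (1 - l) *: (qw + g y).
  apply/rowP => i; rewrite !mxE; field.
  by rewrite !gt_eqF.
have qur := qr _ _ Fu.
have Fw' : F qw y <= mu by rewrite (le_trans Fw)// ltW.
have gy1 i : `|g y ord0 i| <= 1 by rewrite (le_trans (gd y i)).
have qwr := qr _ _ Fw'; have qwgr := qgr _ _ _ Fw' gy1.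
have [xz1 xz2] := dist _ _ Bx Bz; have [yz1 yz2] := dist _ _ By Bz.
have Fuz : F qu z < mu + (1 - l) * ((mu - mu') / 2).
  have : `|F qu x - F qu z| < (1 - l) * ((mu - mu') / 2).
    by apply: Fd2; rewrite ?subrr ?normr0.
  rewrite ltr_norml => /andP[h _]; lra.
have Fwz : F (qw + g y) z < mu' + (mu - mu') / 2.
  have : `|F qw y - F (qw + g y) z| < (mu - mu') / 2.
    apply: Fd1 => //; rewrite opprD addNKr normrN.
    by apply: norm_ltP => // i; rewrite (le_lt_trans (gd y i)).
  rewrite ltr_norml => /andP[h _]; lra.
have l01 : 0 <= l <= 1 by rewrite !ltW.
have := F_convex qu (qw + g y) z l01; rewrite -qvE => Fc.
have := le_trans Fv Fc.
have : l * F qu z < l * (mu + (1 - l) * ((mu - mu') / 2)) by rewrite ltr_pM2l.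
have : (1 - l) * F (qw + g y) z < (1 - l) * (mu' + (mu - mu') / 2) by rewrite ltr_pM2l.
have : 0 <= (1 - l) * ((1 - l) * (mu - mu')) by rewrite !mulr_ge0// ltW.
nra.
Qed.

Hypothesis boundary_compact : compact (Q `\` U).
Hypothesis u_growth : exists M C : R, 0 < M /\ forall x, Q x -> u x <= M * enorm x + C.
Hypothesis v_growth : exists c C : R, 0 < c /\ forall x, Q x -> c * enorm x - C <= v x.
Hypothesis w_growth : forall e : R, 0 < e ->
  exists C, forall x, `|w x| <= e * enorm x + C.

Definition dominated (l : R) := exists c C : R,
  0 < c /\ forall x, Q x -> l * u x - v x <= C - c * enorm x.

Lemma dominated_small : exists2 l, 0 < l < 1 & dominated l.
Proof.
have [M [C [M0 uM]]] := u_growth; have [c [C' [c0 vc]]] := v_growth.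
pose l := Num.min (2^-1) (c / (2 * M)).
have l0 : 0 < l by rewrite lt_min invr_gt0 ltr0n divr_gt0// mulr_gt0.
have l1 : l < 1 by rewrite gt_min invf_lt1// ltr1n.
have lM : l * M <= c / 2.
  by rewrite -ler_pdivlMr// -mulrA -invfM ge_min lexx orbT.
exists l; first by rewrite l0.
exists (c / 2), (C' + l * C); split; first by rewrite divr_gt0.
move=> x Qx; have := vc x Qx.
have : l * u x <= l * (M * enorm x + C) by rewrite ler_pM2l ?uM.
have : l * M * enorm x <= c / 2 * enorm x by rewrite ler_wpM2r// enorm_ge0.
lra.
Qed.

(* The decay assumed in [dominated] only serves to start the comparison.  Since
   [saturated_cone d k] <= d |x|^2 for every k >= 1, the bound [b] on the
   boundary is independent of k, and k may be chosen to be |x|. *)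
Lemma dominated_improve : exists2 d : R, 0 < d & forall l, 0 < l < 1 ->
  dominated l -> exists C, forall x, Q x ->
    l * u x - v x <= C - (1 - l) * d * enorm x.
Proof.
have [d d0 cmp] := strict_comparison.
exists (d / 4) => [|l l01 [c [C [c0 ldom]]]]; first by rewrite divr_gt0.
have [l0 l1] : 0 < l /\ 0 < 1 - l by rewrite subr_gt0; exact/andP.
have GQ : Q `\` U `<=` Q by move=> x [].
have [b b_bdry] : exists b, forall x, (Q `\` U) x ->
    l * u x + (1 - l) * (w x + d * normsq x) + - v x <= b.
  apply: (usc_within_bounded boundary_compact).
  apply: usc_withinD; last exact: usc_withinS GQ v_lsc.
  apply: usc_withinD; first exact/(usc_withinS GQ)/usc_withinZ.
  apply: usc_withinZ => //; apply: usc_withinD; first exact: continuous_usc_within.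
  apply: usc_withinZ => //; apply: continuous_usc_within; exact: normsq_continuous.
have [Cw wC] := w_growth (divr_gt0 d0 (ltr0Sn R 3)).
have [Cw' wC'] := w_growth (divr_gt0 c0 (ltr0Sn R 1)).
exists (Num.max (b + (1 - l) * Cw) (C + (1 - l) * (d / 4))) => x Qx.
have [x1|x1] := leP (enorm x) 1.
  have h : (1 - l) * (d / 4) * enorm x <= (1 - l) * (d / 4).
    by rewrite ler_piMr// mulr_ge0 ?divr_ge0 ?ltW.
  rewrite lerBrDr (le_trans (y := C + (1 - l) * (d / 4)))//; last first.
    by rewrite le_max lexx orbT.
  apply: lerD => //; rewrite (le_trans (ldom x Qx))// gerBl.
  by rewrite mulr_ge0 ?enorm_ge0 ?ltW.
set k := enorm x; have k0 : 0 < k by rewrite (lt_trans ltr01).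
have [g CS gd] := @saturated_cone_C1 R n d k (ltW d0) k0.
have := cmp l b _ g l01 CS gd _ _ x Qx.
rewrite saturated_cone_at// => H.
have {H} : l * u x + (1 - l) * (w x + d * k / 2) - v x <= b.
  apply: H => [|y Qy nUy]; last first.
    apply: le_trans (b_bdry y (conj Qy nUy)).
    rewrite lerD2r lerD2l ler_wpM2l ?(ltW l1)// lerD2l.
    by rewrite saturated_cone_le_normsq ?(ltW d0)// ltW.
  pose T := Num.max 0 ((C + (1 - l) * (Cw' + d * k) - b) / (c / 2)).
  have T0 : 0 <= T by rewrite le_max lexx.
  exists (T ^+ 2) => y Qy.
  rewrite -enorm_sqr ltr_pXn2r ?nnegrE ?enorm_ge0// gt_max => /andP[_].
  rewrite ltr_pdivrMr ?divr_gt0// => Ty.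
  have h1 := ldom y Qy.
  have h2 : w y + saturated_cone d k y <= c / 2 * enorm y + (Cw' + d * k).
    rewrite addrA lerD ?saturated_cone_le// ?(ltW d0)//.
    exact: le_trans (ler_norm _) (wC' y).
  have h3 : (1 - l) * (w y + saturated_cone d k y) <=
      (1 - l) * (c / 2 * enorm y + (Cw' + d * k)) by rewrite ler_pM2l.
  have h4 : (1 - l) * (c / 2 * enorm y) <= c / 2 * enorm y.
    rewrite ler_piMl ?mulr_ge0 ?enorm_ge0 ?divr_ge0 ?(ltW c0)//.
    by rewrite gerBl ltW.
  lra.
have := wC x; rewrite ler_norml => /andP[+ _]; rewrite -/k.
rewrite -(ler_pM2l l1) => wx H.
rewrite lerBrDr (le_trans (y := b + (1 - l) * Cw)) ?le_max ?lexx//.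
lra.
Qed.

Lemma dominated_near1 (e : R) : 0 < e ->
  exists l, [/\ 0 < l < 1, 1 - l < e & dominated l].
Proof.
move=> e0; have [d d0 imp] := dominated_improve.
have [M [C [M0 uM]]] := u_growth; have [l /andP[l0 l1] ldom] := dominated_small.
pose r := Num.min (2^-1) (d / (2 * M)).
have r0 : 0 < r by rewrite lt_min invr_gt0 ltr0n divr_gt0// mulr_gt0.
have r1 : r < 1 by rewrite gt_min invf_lt1// ltr1n.
have rM : r * M <= d / 2.
  by rewrite -ler_pdivlMr// -mulrA -invfM ge_min lexx orbT.
have q0 : 0 < 1 - r by rewrite subr_gt0.
have step m : [/\ 0 < 1 - (1 - l) * (1 - r) ^+ m < 1 &
    dominated (1 - (1 - l) * (1 - r) ^+ m)].
  elim: m => [|m [/andP[s0 s1] sdom]].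
    by rewrite expr0 mulr1 opprB addrCA subrr addr0; split=> //; rewrite l0.
  set s := 1 - _ in s0 s1 sdom.
  have -> : 1 - (1 - l) * (1 - r) ^+ m.+1 = s + r * (1 - s).
    by rewrite /s exprS; ring.
  have s1' : 0 < 1 - s by rewrite subr_gt0.
  have rs0 : 0 < r * (1 - s) by rewrite mulr_gt0.
  split.
    rewrite addr_gt0//=; have := mulr_gt0 q0 s1'; lra.
  have [|C' sC'] := imp s _ sdom; first by rewrite s0.
  exists ((1 - s) * (d / 2)), (C' + r * (1 - s) * C); split.
    by rewrite mulr_gt0// divr_gt0.
  move=> x Qx; have := sC' x Qx.
  have : r * (1 - s) * u x <= r * (1 - s) * (M * enorm x + C).
    by rewrite ler_pM2l ?uM.
  have : r * M * ((1 - s) * enorm x) <= d / 2 * ((1 - s) * enorm x).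
    by rewrite ler_wpM2r// mulr_ge0 ?enorm_ge0 ?ltW.
  lra.
have qn1 : `|1 - r| < 1 by rewrite gtr0_norm// gtrBl.
have /cvgrPdist_lt/(_ _ e0)[m _ /(_ m (leqnn m))] := cvg_expr qn1.
rewrite sub0r normrN ger0_norm ?exprn_ge0 ?(ltW q0)// => qme.
have [sl sdom] := step m; exists (1 - (1 - l) * (1 - r) ^+ m); split=> //.
rewrite opprB addrCA subrr addr0 (le_lt_trans _ qme)// ler_piMl ?exprn_ge0 ?(ltW q0)//.
by rewrite gerBl ltW.
Qed.

Lemma comparison (B : R) : (forall x, (Q `\` U) x -> u x - v x <= B) ->
  forall x, Q x -> u x - v x <= B.
Proof.
move=> uvB x Qx; have [d d0 cmp] := strict_comparison.
have GQ : Q `\` U `<=` Q by move=> y [].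
have [A wvA] : exists A, forall y, (Q `\` U) y -> w y + - v y <= A.
  apply: (usc_within_bounded boundary_compact).
  apply: usc_withinD; last exact: usc_withinS GQ v_lsc.
  exact: continuous_usc_within.
rewrite leNgt; apply/negP => Buv.
set t := u x - v x - B; have t0 : 0 < t by rewrite subr_gt0.
set a := `|w x - v x - A|.
have ta0 : 0 < t + a by rewrite ltr_wpDr// normr_ge0.
have [l [l01 l1t [c [C [c0 ldom]]]]] := dominated_near1 (divr_gt0 t0 ta0).
have [l0 l1] : 0 < l /\ 0 < 1 - l by rewrite subr_gt0; exact/andP.
have : l * u x + (1 - l) * (w x + 0) - v x <= l * B + (1 - l) * A.
  apply: (cmp _ _ (fun=> 0) (fun=> 0)) => //.
  - exact: C1_with_grad_cst.
  - by move=> y i; rewrite mxE normr0 ltW.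
  - have [Cw wC] := w_growth (divr_gt0 c0 (ltr0Sn R 1)).
    pose T := Num.max 0 ((C + (1 - l) * Cw - (l * B + (1 - l) * A)) / (c / 2)).
    have T0 : 0 <= T by rewrite le_max lexx.
    exists (T ^+ 2) => y Qy.
    rewrite -enorm_sqr ltr_pXn2r ?nnegrE ?enorm_ge0// gt_max => /andP[_].
    rewrite ltr_pdivrMr ?divr_gt0// => Ty.
    have h1 := ldom y Qy.
    have h3 : (1 - l) * w y <= (1 - l) * (c / 2 * enorm y + Cw).
      by rewrite ler_pM2l//; exact: le_trans (ler_norm _) (wC y).
    have h4 : (1 - l) * (c / 2 * enorm y) <= c / 2 * enorm y.
      rewrite ler_piMl ?mulr_ge0 ?enorm_ge0 ?divr_ge0 ?(ltW c0)//.
      by rewrite gerBl ltW.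
    lra.
  - move=> y Qy nUy.
    have : l * (u y - v y) <= l * B by rewrite ler_pM2l// uvB.
    have : (1 - l) * (w y + - v y) <= (1 - l) * A by rewrite ler_pM2l// wvA.
    lra.
have : (1 - l) * - a <= (1 - l) * (w x - v x - A).
  by rewrite ler_pM2l// lerNl /a -normrN ler_norm.
move: l1t; rewrite ltr_pdivlMr// /t; lra.
Qed.

End Comparison.

Section Hamiltonian.
Context {R : realType} {n : nat}.
Variables (H : 'rV[R]_n -> 'rV[R]_n -> R) (p : 'rV[R]_n).

Lemma shiftH_convex :
  (forall y : 'rV[R]_n, convex_function [set: 'rV[R]_n] (H ^~ y)) ->
  forall (t : R) (a b y : 'rV[R]_n), 0 <= t <= 1 ->
  shiftH H p (t *: a + (1 - t) *: b) y <=
    t * shiftH H p a y + (1 - t) * shiftH H p b y.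
Proof.
move=> Hc t a b y /andP[t0 t1].
have pE : p + (t *: a + (1 - t) *: b) = t *: (p + a) + (1 - t) *: (p + b).
  by rewrite !scalerDr addrACA -scalerDl subrKC scale1r.
have := Hc y (Itv01 t0 t1) (p + a) (p + b); rewrite !inE => /(_ Logic.I Logic.I).
by rewrite /shiftH pE.
Qed.

Lemma shiftH_coercive :
  ereal_inf [set (H q y)%:E | y in [set: 'rV[R]_n]] @[q --> at_infty] --> +oo%E ->
  forall m, exists r, forall q y, shiftH H p q y <= m -> normsq q <= r.
Proof.
move=> /cvgeyPgt Hc m; have [M HM] := Hc m.
exists (2 * (Num.max M 0) ^+ 2 + 2 * normsq p) => q y Hqm.
have pqM : enorm (p + q) <= M.
  rewrite leNgt; apply/negP => /HM /= mH.
  have : (m%:E < (H (p + q) y)%:E)%E.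
    by apply: (lt_le_trans mH); apply: ereal_inf_lbound; exists y.
  by rewrite lte_fin ltNge; apply/negP/negPn.
have := normsqD (p + q) (- p); rewrite normsqN addrAC subrr add0r => /le_trans; apply.
rewrite lerD2r ler_pM2l// -enorm_sqr lerXn2r ?nnegrE ?enorm_ge0//.
  by rewrite le_max lexx orbT.
by rewrite le_max pqM.
Qed.

Lemma shiftH_unif :
  (forall r : R, 0 < r -> unif_continuous
      (fun z : subspace (eball r `*` [set: 'rV[R]_n]) => H z.1 z.2)) ->
  forall r e : R, 0 < e -> exists2 d : R, 0 < d &
    forall q1 q2 y1 y2 : 'rV[R]_n, normsq q1 < r -> normsq q2 < r ->
    `|q1 - q2| < d -> `|y1 - y2| < d ->
    `|shiftH H p q1 y1 - shiftH H p q2 y2| < e.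
Proof.
move=> Hu r e e0.
pose s := Num.max r 0 + normsq p + 1.
have s1 : 1 <= s by rewrite lerDr addr_ge0 ?normsq_ge0// le_max lexx orbT.
have s0 : 0 < 2 * s by rewrite mulr_gt0// (lt_le_trans ltr01).
have ballq (q : 'rV[R]_n) : normsq q < r -> enorm (p + q) < 2 * s.
  move=> qr; rewrite -(@ltr_pXn2r _ 2)// ?nnegrE ?enorm_ge0 ?(ltW s0)//.
  rewrite enorm_sqr (le_lt_trans (normsqD _ _))//.
  have : normsq q < Num.max r 0 by rewrite lt_max qr.
  move: s1; rewrite /s.
  have : 0 <= Num.max r 0 by rewrite le_max lexx orbT.
  have := normsq_ge0 p; nra.
have [|E + HE] := Hu _ s0 [set xy | `|xy.1 - xy.2| < e].
  rewrite -entourage_ballE; exists e => //= xy; by rewrite -ball_normE.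
rewrite -entourage_ballE => -[d /= d0 dE]; exists d => // q1 q2 y1 y2 q1r q2r q12 y12.
apply: (HE ((p + q1, y1), (p + q2, y2))); right; split; [|split] => /=.
- by split => //=; exact: ballq.
- by split => //=; exact: ballq.
apply: dE; split => /=; rewrite -ball_normE//=.
by rewrite opprD addrACA subrr add0r.
Qed.

End Hamiltonian.

Section Growth.
Context {R : realType} {n : nat}.
Implicit Types (Q : set 'rV[R]_n) (u v w : 'rV[R]_n -> R).

Lemma lipschitz_continuous w : lipschitz w -> continuous w.
Proof.
move=> /pinfty_ex_gt0[k k0 wk] x; apply/(@cvgrPdist_lt _ _ _ (nbhs x)) => e e0.
apply/nbhs_ballP; exists (e / k) => /=; first exact: divr_gt0.
move=> y; rewrite -ball_normE /= ltr_pdivlMr// mulrC; apply: le_lt_trans.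
exact: (wk (x, y)).
Qed.

Lemma usc_linear_growth Q u : closed Q -> usc_within Q u ->
  (limf_esup (fun x => (u x / enorm x)%:E) at_infty < +oo)%E ->
  exists M C : R, 0 < M /\ forall x, Q x -> u x <= M * enorm x + C.
Proof.
move=> Qc uQ /ereal_inf_lt[_ [V [N VN] <-] supV].
have [M M0 VM] : exists2 M : R, 0 < M & forall x, V x -> u x / enorm x <= M.
  case E : (ereal_sup _) supV => [s| |]// _.
    exists (Num.max s 1); first by rewrite lt_max ltr01 orbT.
    move=> x Vx; rewrite le_max -lee_fin -E; apply/orP; left.
    by apply: ereal_sup_ubound; exists x.
  exists 1 => // x Vx; have : ((u x / enorm x)%:E <= -oo)%E.
    by rewrite -E; apply: ereal_sup_ubound; exists x.
  by rewrite leeNy_eq.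
have cB := @normsq_ball_compact R n Q Qc ((Num.max N 0) ^+ 2).
have [C uC] := usc_within_bounded cB (usc_withinS (@subIsetl _ _ _) uQ).
exists M, (Num.max C 0); split=> // x Qx.
have [xN|Nx] := leP (enorm x) (Num.max N 0).
  have : u x <= C.
    apply: uC; split=> //=.
    by rewrite -enorm_sqr lerXn2r ?nnegrE ?enorm_ge0// le_max lexx orbT.
  move=> /le_trans; apply; rewrite ler_wpDl ?mulr_ge0 ?enorm_ge0 ?(ltW M0)//.
  by rewrite le_max lexx.
move: Nx; rewrite gt_max => /andP[/VN/VM + x0].
rewrite ler_pdivrMr// => /le_trans; apply.
by rewrite lerDl le_max lexx orbT.
Qed.

Lemma lsc_linear_growth Q v : closed Q -> usc_within Q (fun x => - v x) ->
  (0 < limf_einf (fun x => (v x / enorm x)%:E) at_infty)%E ->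
  exists c C : R, 0 < c /\ forall x, Q x -> c * enorm x - C <= v x.
Proof.
move=> Qc vQ; rewrite limf_einfE => /ereal_sup_gt[_ [V [N VN] <-] infV].
have [c c0 Vc] : exists2 c : R, 0 < c & forall x, V x -> c <= v x / enorm x.
  case E : (ereal_inf _) infV => [s| |]//.
    rewrite lte_fin => s0; exists s => // x Vx; rewrite -lee_fin -E.
    by apply: ereal_inf_lbound; exists x.
  move=> _; exists 1 => // x Vx; have : (+oo <= (v x / enorm x)%:E)%E.
    by rewrite -E; apply: ereal_inf_lbound; exists x.
  by rewrite leye_eq.
have cB := @normsq_ball_compact R n Q Qc ((Num.max N 0) ^+ 2).
have [C vC] := usc_within_bounded cB (usc_withinS (@subIsetl _ _ _) vQ).
exists c, (Num.max 0 (C + c * Num.max N 0)); split=> // x Qx.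
have [xN|Nx] := leP (enorm x) (Num.max N 0).
  have : - v x <= C.
    apply: vC; split=> //=.
    by rewrite -enorm_sqr lerXn2r ?nnegrE ?enorm_ge0// le_max lexx orbT.
  have : c * enorm x <= c * Num.max N 0 by rewrite ler_pM2l.
  have : C + c * Num.max N 0 <= Num.max 0 (C + c * Num.max N 0).
    by rewrite le_max lexx orbT.
  lra.
move: Nx; rewrite gt_max => /andP[/VN/Vc + x0].
rewrite ler_pdivlMr//; apply: le_trans.
by rewrite gerBl le_max lexx.
Qed.

Lemma sublinear_growth w : continuous w -> strictly_sublinear w ->
  forall e : R, 0 < e -> exists C, forall x, `|w x| <= e * enorm x + C.
Proof.
move=> cw /cvgrPdist_lt sw e e0; have [N HN] := sw e e0.
have cB := @normsq_ball_compact R n setT closedT ((Num.max N 0) ^+ 2).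
have [|C wC] := usc_within_bounded cB (f := fun x => `|w x|).
  apply: continuous_usc_within => x.
  by apply: continuous_comp; [exact: cw|exact: norm_continuous].
exists (Num.max C 0) => x.
have [xN|Nx] := leP (enorm x) (Num.max N 0).
  have : `|w x| <= C.
    apply: wC; split=> //=.
    by rewrite -enorm_sqr lerXn2r ?nnegrE ?enorm_ge0// le_max lexx orbT.
  move=> /le_trans; apply; rewrite ler_wpDl ?mulr_ge0 ?enorm_ge0 ?(ltW e0)//.
  by rewrite le_max lexx.
move: Nx; rewrite gt_max => /andP[/HN/= + x0].
rewrite sub0r normrN normrM normfV (gtr0_norm x0) mulrC ltr_pdivrMr// => /ltW/le_trans.
by apply; rewrite lerDl le_max lexx orbT.
Qed.

End Growth.

Unset Implicit Arguments.
Set Strict Implicit.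

Theorem proposition6p1 (R : realType) (n : nat)
  (H : 'rV[R]_n -> 'rV[R]_n -> R)
  (H_convex : forall y : 'rV[R]_n, convex_function [set: 'rV[R]_n] (H ^~ y))
  (H_coercive :
    ereal_inf [set (H q y)%:E | y in [set: 'rV[R]_n]] @[q --> at_infty]
      --> +oo%E)
  (H_unif_continuous : forall r : R, 0 < r ->
    unif_continuous
      (fun z : subspace (eball r `*` [set: 'rV[R]_n]) => H z.1 z.2))
  (H_bounded : forall r : R, 0 < r ->
    [bounded H z.1 z.2 | z in eball r `*` [set: 'rV[R]_n]])
  (p : 'rV[R]_n) (mu : R) (mu_gt : (Hbar H p < mu%:E)%E)
  (D : set 'rV[R]_n) (D_compact : compact D)
  (u v : 'rV[R]_n -> R)
  (u_usc : usc_on (closure (~` D)) u)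
  (v_lsc : lsc_on (closure (~` D)) v)
  (u_sub : visc_subsolution (shiftH H p) mu (~` D) u)
  (v_super : visc_supersolution (shiftH H p) mu (~` D) v)
  (v_growth : (0 < limf_einf (fun x => (v x / enorm x)%:E) at_infty)%E)
  (u_growth : (limf_esup (fun x => (u x / enorm x)%:E) at_infty < +oo)%E) :
  ereal_sup [set (u x - v x)%:E | x in closure (~` D)] =
    ereal_sup [set (u x - v x)%:E | x in boundary D] /\
  ({within closure (~` D), continuous u} ->
   {within closure (~` D), continuous v} ->
   ereal_sup [set (u x - v x)%:E | x in ~` D] =
     ereal_sup [set (u x - v x)%:E | x in boundary D]).
Proof.
have D_closed : closed D by apply: compact_closed => //; exact: norm_hausdorff.
set Q := closure (~` D) in u_usc v_lsc *.
have Qc : closed Q by exact: closed_closure.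
have DQ : ~` D `<=` Q by exact: subset_closure.
have bdE : boundary D = Q `\` ~` D.
  rewrite /boundary /Q closure_setC -(iffLR (closure_id D) D_closed).
  by rewrite !setDE setCK setIC.
have bdQ : boundary D `<=` Q by rewrite bdE => x [].
have bd_compact : compact (Q `\` ~` D).
  rewrite setDE setCK; apply: (subclosed_compact _ D_compact); last exact: subIsetr.
  exact: closedI.
have uQ := usc_within_on u_usc.
have vQ : usc_within Q (fun x => - v x).
  apply: usc_within_on; rewrite /usc_on.
  by under eq_fun do rewrite opprK.
have [_ [mu' [w [wlip wsub wvisc]] <-]] := ereal_inf_lt mu_gt.
rewrite lte_fin => mu'mu.
have cw := lipschitz_continuous wlip.
have cmp := comparison (shiftH_convex p H_convex) (shiftH_coercive p H_coercive)
  (shiftH_unif p H_unif_continuous) mu'mu Qc (closed_openC D_closed) DQ uQ vQ cw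
  u_sub v_super wvisc bd_compact (usc_linear_growth Qc uQ u_growth)
  (lsc_linear_growth Qc vQ v_growth) (sublinear_growth cw wsub).
have supQ : ereal_sup [set (u x - v x)%:E | x in Q] =
    ereal_sup [set (u x - v x)%:E | x in boundary D].
  apply/eqP; rewrite eq_le; apply/andP; split; last first.
    by apply: ereal_sup_le => _ [x /bdQ Qx <-]; exists x.
  apply: ge_ereal_sup => _ [x Qx <-].
  case E : (ereal_sup _) => [B| |]; last 2 first.
  - by rewrite leey.
  - have : u x - v x <= u x - v x - 1.
      apply: cmp Qx => y; rewrite -bdE => By.
      have : ((u y - v y)%:E <= -oo)%E.
        by rewrite -E; apply: ereal_sup_ubound; exists y.
      by rewrite leeNy_eq.
    by rewrite lerDl oppr_ge0 ler10.
  rewrite lee_fin; apply: cmp Qx => y; rewrite -bdE => By.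
  by rewrite -lee_fin -E; apply: ereal_sup_ubound; exists y.
split=> // cu cv; rewrite -supQ; apply/eqP; rewrite eq_le; apply/andP; split.
  by apply: ereal_sup_le => _ [x /DQ Qx <-]; exists x.
apply: ge_ereal_sup => _ [x Qx <-].
rewrite leNgt; apply/negP => supuv.
have [s sup_s suv] : exists2 s : R,
    (ereal_sup [set (u x - v x)%:E | x in ~` D] <= s%:E)%E & s < u x - v x.
  case: (ereal_sup _) supuv => [s| |]; first by rewrite lte_fin; exists s.
  - by rewrite ltNge leey.
  - by exists (u x - v x - 1); rewrite ?leNye// ltrBlDr ltrDl.
have : usc_within Q (fun y => v y - u y).
  move=> y Qy a vua; rewrite nbhs_subspace_in//.
  pose FF := nbhs_filter (y : subspace Q).
  exact: (@cvgB _ _ _ _ FF _ _ _ _ (cv y) (cu y) _ (lt_nbhsl vua)).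
rewrite ltrBrDr -ltrBrDl in suv.
move=> /(_ x Qx (- s)); rewrite near_withinE.
have /[swap]/[apply] : v x - u x < - s by lra.
move=> /Qx[y [Dy /(_ (DQ y Dy))]].
have : ((u y - v y)%:E <= s%:E)%E.
  by apply: le_trans sup_s; apply: ereal_sup_ubound; exists y.
rewrite lee_fin; lra.
Qed.
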